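(* For all $n\ge1$, we have $$c_n(1322,2231)=\binom{2n}{n}-2^{n-1}.$$
   Context: A word $\pi=\pi_1\dots\pi_m$ over the positive integers contains the pattern $\sigma=\sigma_1\dots\sigma_k$ if there are indices $1\le i_1<\dots<i_k\le m$ such that for all $r,s\in\{1,\dots,k\}$: $\pi_{i_r}<\pi_{i_s}$ iff $\sigma_r<\sigma_s$, and $\pi_{i_r}=\pi_{i_s}$ iff $\sigma_r=\sigma_s$; otherwise $\pi$ avoids $\sigma$. $\mathcal{C}_n$ denotes the set of nonnesting permutations: arrangements (words) of the multiset $\{1,1,2,2,\dots,n,n\}$ that avoid the patterns $1221$ and $2112$. For patterns $\sigma,\tau,\dots$, $c_n(\sigma,\tau,\dots)$ is the number of $\pi\in\mathcal{C}_n$ avoiding all of $\sigma,\tau,\dots$. *)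

(* Defs.v *)
From mathcomp Require Import all_boot.

Set Implicit Arguments.
Unset Strict Implicit.
Unset Printing Implicit Defensive.

(* [f] sends the positions of the pattern [p] to the positions i_1 < ... < i_k
   of an occurrence of [p] in the word [w]; positions are numbered from 0. *)
Definition occurrence (w p : seq nat) (f : {ffun 'I_(size p) -> 'I_(size w)}) :
    bool :=
  [forall r : 'I_(size p), forall s : 'I_(size p),
    [&& (r < s) ==> (f r < f s),
        (nth 0 w (f r) < nth 0 w (f s)) == (nth 0 p r < nth 0 p s) &
        (nth 0 w (f r) == nth 0 w (f s)) == (nth 0 p r == nth 0 p s)]].

Definition contains (w p : seq nat) : bool :=
  [exists f : {ffun 'I_(size p) -> 'I_(size w)}, occurrence f].

Definition avoids (w p : seq nat) : bool := ~~ contains w p.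

Definition double_multiset (n : nat) : seq nat :=
  flatten [seq [:: i; i] | i <- iota 1 n].

(* [permutations s] lists every distinct rearrangement of [s] exactly once,
   also when [s] has repeated letters. *)
Definition nonnesting (n : nat) : seq (seq nat) :=
  [seq w <- permutations (double_multiset n) |
    avoids w [:: 1; 2; 2; 1] && avoids w [:: 2; 1; 1; 2]].

Definition num_avoiding (n : nat) (ps : seq (seq nat)) : nat :=
  count (fun w => all (avoids w) ps) (nonnesting n).

(* Main.v *)
Require Import Defs.
From mathcomp Require Import all_boot.
From mathcomp Require Import zify.

(** The class consists of the nonnesting words that avoid 1322 and 2231.  Let
    [M = n+1] be the largest letter.  For [n > 0], a word of the class on
    [n+1] letters either starts or ends with [M], but not both
    ([head_last_max]); deleting both copies of [M] leaves a word of the class on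
    [n] letters, and reversal, which exchanges 1322 with 2231 and preserves the
    nonnesting condition, exchanges the two cases.  So it is enough to know
    which words [M p M s] arise from a word [p s] of the class.  The answer is
    simple ([avoider_wrapE]): exactly those for which [p] is an arrangement of
    the [|p|] largest letters of [p s].  Indeed [p] has no repeated letter since
    [M x x M] is forbidden, and if [a] is in [p] and [b > a] is not, then both
    copies of [b] lie in [s], and [a M b b] is an occurrence of 1322.

    Hence the words of the class form a generating tree in which the children
    of [w] correspond to the prefixes of [w] and of its reversal that consist
    of the largest letters; call such a prefix a top prefix.  Two kinds of nodes
    occur.  The word is full if its prefix of length [n] is a top prefix, that
    is, if this prefix is a permutation.  Let [a] and [b] be the numbers of top
    prefixes of length less than [n] of [w] and of its reversal.  One of [a] and
    [b] is always 1, and with the label [k = a + b - 2] the succession rule is: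
    a word that is not full has children, none of them full, with labels
    1, 2, ..., k+1 and 1; a full word has the same children and in addition two
    full ones with labels [k+1] and 1.

    A word that is not full, with label [k], has [C(2r+k, r)] descendants [r]
    levels below: this is [free_countS], a form of Pascal's rule.  A full word
    has [C(2r+k+1, r) + C(2r+1, r) - 2^r] of them ([full_countS],
    [full_excessE]).  The root 11 is full with label 0, and with [r = n-1] the
    second formula gives [2 C(2n-1, n-1) - 2^(n-1) = C(2n, n) - 2^(n-1)]. *)

Set Implicit Arguments.
Unset Strict Implicit.
Unset Printing Implicit Defensive.

(** * Pattern containment through subsequences *)

Lemma ltn_sorted_subseq_iota n s :
  sorted ltn s -> all (fun i => i < n) s -> subseq s (iota 0 n).
Proof.
move=> srt_s lt_s_n.
have -> : s = [seq i <- iota 0 n | i \in s]; last exact: filter_subseq.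
apply: (irr_sorted_eq ltn_trans ltnn) => //.
- by apply: sorted_filter (iota_ltn_sorted 0 n) => //; exact: ltn_trans.
- move=> i; rewrite mem_filter mem_iota /=.
  by case: (boolP (i \in s)) => // /(allP lt_s_n) ->.
Qed.

(** The relations are tested on positions, so that for a concrete pattern the
    predicate reduces to a conjunction of comparisons between letters. *)
Definition order_iso (s p : seq nat) : bool :=
  (size s == size p) &&
  all (fun i => all (fun j =>
    ((nth 0 s i < nth 0 s j) == (nth 0 p i < nth 0 p j)) &&
    ((nth 0 s i == nth 0 s j) == (nth 0 p i == nth 0 p j)))
    (iota 0 (size p))) (iota 0 (size p)).

(** Replaces embeddings of positions by subsequences, for which deletion,
    concatenation and reversal are easy to handle. *)
Lemma containsP w p :
  reflect (exists2 s, subseq s w & order_iso s p) (contains w p).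
Proof.
apply: (iffP existsP) => [[f /forallP occ_f]|[s /subseqP[m sz_m def_s]]].
- pose pos := [seq nat_of_ord (f r) | r <- enum 'I_(size p)].
  have sz_pos : size pos = size p by rewrite size_map size_enum_ord.
  have nth_pos (r : 'I_(size p)) : nth 0 pos r = f r.
    by rewrite (nth_map r) ?nth_ord_enum // size_enum_ord.
  exists [seq nth 0 w i | i <- pos].
    rewrite -{2}(mkseq_nth 0 w); apply: map_subseq.
    apply: ltn_sorted_subseq_iota; last first.
      by apply/allP=> _ /mapP[r _ ->]; exact: ltn_ord.
    apply/(sortedP 0) => i; rewrite sz_pos => lt_i.
    have /forallP/(_ (Ordinal lt_i)) := occ_f (Ordinal (ltnW lt_i)).
    by rewrite -!nth_pos /= ltnSn => /and3P[].
  rewrite /order_iso size_map sz_pos eqxx /=; apply/allP => i.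
  rewrite mem_iota /= add0n => lt_i; apply/allP => j.
  rewrite mem_iota /= add0n => lt_j.
  have /forallP/(_ (Ordinal lt_j)) := occ_f (Ordinal lt_i).
  by rewrite -!nth_pos /= !(nth_map 0) ?sz_pos // => /and3P[_ -> ->].
- case/andP=> /eqP sz_s iso_s.
  pose pos := mask m (iota 0 (size w)).
  have def_s' : s = [seq nth 0 w i | i <- pos].
    by rewrite /pos map_mask -/(mkseq _ _) mkseq_nth.
  have sz_pos : size pos = size p by rewrite -sz_s def_s' size_map.
  have lt_pos (r : 'I_(size p)) : nth 0 pos r < size w.
    have: nth 0 pos r \in iota 0 (size w).
      by apply: (mem_mask (m := m)); rewrite -/pos mem_nth ?sz_pos.
    by rewrite mem_iota.
  exists [ffun r => Ordinal (lt_pos r)].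
  have srt_pos : sorted ltn pos.
    by apply: sorted_mask (iota_ltn_sorted 0 _); exact: ltn_trans.
  apply/forallP => r; apply/forallP => r'; rewrite !ffunE /=.
  apply/andP; split.
    apply/implyP => lt_rr'.
    by apply: (sorted_ltn_nth ltn_trans 0 srt_pos) => //; rewrite inE sz_pos.
  have := allP iso_s r; rewrite mem_iota /= => /(_ (ltn_ord r))/allP/(_ r').
  by rewrite mem_iota /= def_s' !(nth_map 0) ?sz_pos // => /(_ (ltn_ord _)).
Qed.

Lemma avoidsP w p :
  reflect (forall s, order_iso s p -> ~~ subseq s w) (avoids w p).
Proof.
apply: (iffP idP) => [av s iso|av].
  by apply: contra av => sub; apply/containsP; exists s.
by apply/containsP => -[s sub iso]; case/negP: (av s iso).
Qed.

Lemma order_iso_nth s p i j : order_iso s p -> i < size p -> j < size p ->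
  ((nth 0 s i < nth 0 s j) = (nth 0 p i < nth 0 p j)) *
  ((nth 0 s i == nth 0 s j) = (nth 0 p i == nth 0 p j)).
Proof.
case/andP=> _ /allP iso lt_i lt_j.
have := iso i; rewrite mem_iota => /(_ lt_i)/allP/(_ j).
by rewrite mem_iota => /(_ lt_j)/andP[/eqP ? /eqP ?].
Qed.

Lemma order_iso1221 s :
  order_iso s [:: 1; 2; 2; 1] -> exists a b, a < b /\ s = [:: a; b; b; a].
Proof.
move=> iso; have e i j := @order_iso_nth s _ i j iso.
have [] := andP iso; case: s {iso} e => [|x [|y [|z [|t []]]]] // e _ _.
exists x, y; move: (e 0 1 isT isT) (e 2 1 isT isT) (e 3 0 isT isT) => /=.
by case=> -> _ [_ /eqP->] [_ /eqP->].
Qed.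

Lemma order_iso2112 s :
  order_iso s [:: 2; 1; 1; 2] -> exists a b, a < b /\ s = [:: b; a; a; b].
Proof.
move=> iso; have e i j := @order_iso_nth s _ i j iso.
have [] := andP iso; case: s {iso} e => [|x [|y [|z [|t []]]]] // e _ _.
exists y, x; move: (e 1 0 isT isT) (e 2 1 isT isT) (e 3 0 isT isT) => /=.
by case=> -> _ [_ /eqP->] [_ /eqP->].
Qed.

Lemma order_iso1322 s : order_iso s [:: 1; 3; 2; 2] ->
  exists a b c, a < b < c /\ s = [:: a; c; b; b].
Proof.
move=> iso; have e i j := @order_iso_nth s _ i j iso.
have [] := andP iso; case: s {iso} e => [|x [|y [|z [|t []]]]] // e _ _.
exists x, z, y; move: (e 0 2 isT isT) (e 2 1 isT isT) (e 3 2 isT isT) => /=.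
by case=> -> _ [-> _] [_ /eqP->].
Qed.

Lemma order_iso2231 s : order_iso s [:: 2; 2; 3; 1] ->
  exists a b c, a < b < c /\ s = [:: b; b; c; a].
Proof.
move=> iso; have e i j := @order_iso_nth s _ i j iso.
have [] := andP iso; case: s {iso} e => [|x [|y [|z [|t []]]]] // e _ _.
exists t, x, z; move: (e 3 0 isT isT) (e 0 2 isT isT) (e 1 0 isT isT) => /=.
by case=> -> _ [-> _] [_ /eqP->].
Qed.

(** * The class of words *)

(** The patterns 1221 and 2112 are the two orderings of the single condition
    that no letter is nested in another one. *)
Definition avoider n (w : seq nat) : Prop :=
  [/\ perm_eq w (double_multiset n),
      forall a b, a != b -> ~~ subseq [:: a; b; b; a] w,
      forall a b c, a < b < c -> ~~ subseq [:: a; c; b; b] w &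
      forall a b c, a < b < c -> ~~ subseq [:: b; b; c; a] w].

Definition avoiders n : seq (seq nat) :=
  [seq w <- nonnesting n |
     all (avoids w) [:: [:: 1; 3; 2; 2]; [:: 2; 2; 3; 1]]].

Lemma mem_avoiders n w : reflect (avoider n w) (w \in avoiders n).
Proof.
rewrite mem_filter mem_filter mem_permutations /= andbT.
apply: (iffP idP) => [|[perm_w av1 av2 av3]].
- case/and3P=> /andP[/avoidsP av1 /avoidsP av2].
  case/andP=> /avoidsP av3 /avoidsP av4 perm_w; split=> // a b.
  + rewrite neq_ltn => /orP[lt_ab|lt_ba].
      by apply: av3; rewrite /order_iso /= !ltnn !eqxx; lia.
    by apply: av4; rewrite /order_iso /= !ltnn !eqxx; lia.
  + by move=> c lt_abc; apply: av1; rewrite /order_iso /= !ltnn !eqxx; lia.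
  + by move=> c lt_abc; apply: av2; rewrite /order_iso /= !ltnn !eqxx; lia.
- rewrite perm_w andbT; apply/andP; split; apply/andP; split; apply/avoidsP => s.
  + by case/order_iso1322=> a [b] [c] [lt_abc ->]; exact: av2.
  + by case/order_iso2231=> a [b] [c] [lt_abc ->]; exact: av3.
  + by case/order_iso1221=> a [b] [lt_ab ->]; apply: av1; rewrite ltn_eqF.
  + by case/order_iso2112=> a [b] [lt_ab ->]; apply: av1; rewrite gtn_eqF.
Qed.

Lemma avoiders_uniq n : uniq (avoiders n).
Proof. by rewrite !filter_uniq ?permutations_uniq. Qed.

Lemma avoider_rev n w : avoider n w -> avoider n (rev w).
Proof.
case=> perm_w av1 av2 av3; split; first by rewrite perm_rev.
- by move=> a b /av1; rewrite -subseq_rev.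
- by move=> a b c /av3; rewrite -subseq_rev.
- by move=> a b c /av2; rewrite -subseq_rev.
Qed.

Lemma count_double_multiset n x :
  count_mem x (double_multiset n) = (0 < x <= n) * 2.
Proof.
rewrite /double_multiset.
have -> : (0 < x <= n) * 2 = (x \in iota 1 n) * 2 by rewrite mem_iota add1n.
rewrite -count_uniq_mem ?iota_uniq //.
elim: (iota 1 n) => //= i s ->; lia.
Qed.

Section Avoider.

Variables (n : nat) (w : seq nat).
Hypothesis av_w : avoider n w.

Lemma count_avoider x : count_mem x w = (0 < x <= n) * 2.
Proof.
by case: av_w => /permP/(_ (pred1 x)) ->; rewrite count_double_multiset.
Qed.

Lemma mem_avoider x : (x \in w) = (0 < x <= n).
Proof. by rewrite -has_pred1 has_count count_avoider; lia. Qed.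

Lemma size_avoider : size w = n * 2.
Proof.
case: av_w => /perm_size -> _ _ _; rewrite /double_multiset.
by rewrite -{2}(size_iota 1 n); elim: (iota 1 n) => //= i s ->; lia.
Qed.

End Avoider.

Lemma perm_double_multiset n w :
  (forall x, count_mem x w = (0 < x <= n) * 2) -> perm_eq w (double_multiset n).
Proof.
by move=> count_w; apply/allP => x _ /=; rewrite count_w count_double_multiset.
Qed.

(** * Adding the largest letter in front *)

(** A letter with a single occurrence has only one place where it can be
    matched, and so it cuts both words into independent halves. *)
Lemma subseq_cat_split (T : eqType) (M : T) (p s t u : seq T) :
  M \notin p -> M \notin s ->
  subseq (t ++ M :: u) (p ++ M :: s) -> subseq t p && subseq u s.
Proof.
move=> Mp Ms; elim: p t Mp => [|y p IHp] [|x t] /=; rewrite ?inE ?negb_or.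
- by rewrite eqxx.
- move=> _; case: eqP => [_|_] sub.
    by case/negP: Ms; apply: (mem_subseq sub); rewrite mem_cat mem_head orbT.
  case/negP: Ms; apply: (mem_subseq sub).
  by rewrite inE mem_cat mem_head !orbT.
- by case/andP=> /negPf-> Mp /(IHp [::] Mp); rewrite sub0seq.
- by case/andP=> _ Mp; case: eqP => _ => [|/(IHp (x :: t) Mp) //]; exact: IHp.
Qed.

Lemma subseq_pair (T : eqType) (x : T) s :
  subseq [:: x; x] s = (1 < count_mem x s).
Proof.
elim: s => //= y s IHs; rewrite [y == x]eq_sym; case: eqP => // _.
by rewrite sub1seq -has_pred1 has_count.
Qed.

Lemma uniq_subseq_pair (T : eqType) (s : seq T) :
  (forall x, ~~ subseq [:: x; x] s) -> uniq s.
Proof.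
move=> no2; apply: count_mem_uniq => x; move: (no2 x); rewrite subseq_pair.
by rewrite -has_pred1 has_count; case: (count_mem x s) => [|[]].
Qed.

Definition top_letters n (s : seq nat) : bool :=
  perm_eq s (iota (n.+1 - size s) (size s)).

Lemma mem_top_letters n s x : size s <= n -> top_letters n s ->
  (x \in s) = (n - size s < x <= n).
Proof. by move=> le_s_n /perm_mem ->; rewrite mem_iota; lia. Qed.

Lemma top_letters_uniq n s : top_letters n s -> uniq s.
Proof. by move/perm_uniq ->; exact: iota_uniq. Qed.

Lemma filter_upset_iota (P : pred nat) n :
  (forall x y, 0 < x -> x < y -> y <= n -> P x -> P y) ->
  let k := count P (iota 1 n) in filter P (iota 1 n) = iota (n.+1 - k) k.
Proof.
elim: n => [//|n IHn] up.
have -> : iota 1 n.+1 = iota 1 n ++ [:: n.+1] by rewrite -[in LHS](addn1 n) iotaD.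
rewrite /= filter_cat count_cat /=.
rewrite IHn => [|x y x0 xy yn]; last by apply: up => //; lia.
case PM: (P n.+1) => /=; last first.
  suff -> : count P (iota 1 n) = 0 by [].
  apply/eqP; rewrite -leqn0 leqNgt -has_count; apply/hasPn => x.
  rewrite mem_iota => /andP[x0 xn]; apply/negP => /(up x n.+1 x0) PMx.
  by move: PM; rewrite PMx //; lia.
have := count_size P (iota 1 n); rewrite size_iota => le_k.
by rewrite -addn1 iotaD /= !addn1 subSS; congr (_ ++ [:: _]); lia.
Qed.

(** A set of letters closed upwards inside [1..n] is a final segment; this is
    how pattern avoidance, which only says that [p] is closed upwards,
    determines the letters of [p]. *)
Lemma upset_top_letters n s :
  uniq s -> {subset s <= iota 1 n} ->
  (forall x y, x \in s -> x < y -> y <= n -> y \in s) -> top_letters n s.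
Proof.
move=> uniq_s sub_s up.
have perm_s : perm_eq s [seq x <- iota 1 n | x \in s].
  apply: uniq_perm => //; first by rewrite filter_uniq ?iota_uniq.
  by move=> x; rewrite mem_filter; case: (boolP (x \in s)) => // /sub_s.
rewrite /top_letters {2}(perm_size perm_s) (perm_size perm_s) size_filter.
rewrite -filter_upset_iota // => x y _ lt_xy le_yn x_s; exact: up lt_xy le_yn.
Qed.

Definition wrap n j (w : seq nat) : seq nat :=
  n.+1 :: take j w ++ n.+1 :: drop j w.

(** Deleting both copies of [n+1] preserves avoidance, so only the occurrences
    that use [n+1] matter.  Being maximal, [n+1] can play 1 or 2 in the nesting
    patterns and only 3 in 1322 and 2231.  As its first copy stands at the
    head, it is the second copy that serves as a 3, and the patterns become
    conditions on [p] and [s]: [n+1, x, x, n+1] and [x, x, n+1, y] need a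
    repeated letter of [p], and [x, n+1, y, y] needs a letter of [p] smaller
    than a letter absent from [p]. *)
Lemma avoider_wrapE n p s :
  avoider n.+1 (n.+1 :: p ++ n.+1 :: s) <->
  avoider n (p ++ s) /\ top_letters n p.
Proof.
set v := n.+1 :: _.
have count_v x : count_mem x v = (x == n.+1) * 2 + count_mem x (p ++ s).
  by rewrite /v /= !count_cat /= [n.+1 == x]eq_sym; lia.
have sub_v : subseq (p ++ s) v.
  apply: (subseq_trans _ (subseq_cons _ _)).
  by apply: cat_subseq => //; exact: subseq_cons.
split=> [av_v|[av_w top_p]].
- have [_ av1 av2 av3] := av_v.
  have count_w x : count_mem x (p ++ s) = (0 < x <= n) * 2.
    by have := count_v x; rewrite (count_avoider av_v); case: eqP; lia.
  have mem_p x : x \in p -> 0 < x <= n.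
    move=> x_p; have : 0 < count_mem x (p ++ s).
      by rewrite -has_count has_pred1 mem_cat x_p.
    by rewrite count_w; case: (0 < x <= n).
  split.
    split; first exact: perm_double_multiset.
    + by move=> a b /av1; apply: contra => /subseq_trans; exact.
    + by move=> a b c /av2; apply: contra => /subseq_trans; exact.
    + by move=> a b c /av3; apply: contra => /subseq_trans; exact.
  apply: upset_top_letters.
  + apply: uniq_subseq_pair => x; apply/negP => sub.
    have x_p : x \in p by apply: (mem_subseq sub); rewrite mem_head.
    have : n.+1 != x by have := mem_p x x_p; lia.
    move/av1/negP; apply; rewrite /v /= eqxx.
    rewrite -[[:: x; x; n.+1]]/([:: x; x] ++ [:: n.+1]).
    by rewrite cat_subseq //= eqxx sub0seq.
  + by move=> x /mem_p; rewrite mem_iota add1n.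
  + move=> x y x_p lt_xy le_yn; apply/negPn/negP => y_p.
    have sub : subseq [:: y; y] s.
      rewrite subseq_pair; have := count_w y; rewrite count_cat.
      by rewrite (count_memPn y_p); lia.
    have : x < y < n.+1 by lia.
    case/av2/negP; apply: (subseq_trans _ (subseq_cons _ _)).
    rewrite -[[:: x; n.+1; y; y]]/([:: x] ++ [:: n.+1] ++ [:: y; y]).
    by rewrite cat_subseq ?sub1seq //= eqxx.
- have [_ av1 av2 av3] := av_w.
  have count_w := count_avoider av_w.
  have countM : count_mem n.+1 (p ++ s) = 0 by rewrite count_w; lia.
  have Mw : n.+1 \notin p ++ s by apply/count_memPn.
  have /andP[Mp Ms] : (n.+1 \notin p) && (n.+1 \notin s).
    by move: Mw; rewrite mem_cat negb_or.
  have perm_v : perm_eq v (double_multiset n.+1).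
    by apply: perm_double_multiset => x; rewrite count_v count_w; case: eqP; lia.
  have mem_v x : x \in v -> x <= n.+1.
    move/perm_mem: perm_v => ->; rewrite -has_pred1 has_count.
    by rewrite count_double_multiset; lia.
  (* An occurrence that misses the new letter already lies in [p ++ s]. *)
  have old t : subseq t v -> n.+1 \notin t -> subseq t (p ++ s).
    move=> sub Mt; have -> : p ++ s = [seq x <- v | x != n.+1].
      rewrite /v /= eqxx /= filter_cat /= eqxx /=.
      rewrite -filter_cat; apply/esym/all_filterP/allP => x.
      by apply: contraL => /eqP->.
    by rewrite subseq_filter sub andbT; apply/allP => x; apply: contraL => /eqP->.
  have uniq_p := top_letters_uniq top_p.
  have no_pair x : ~~ subseq [:: x; x] p.
    by rewrite subseq_pair count_uniq_mem //; case: (x \in p).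
  (* Only an occurrence that starts with the new letter can use its first copy. *)
  have tailM t : head 0 t != n.+1 -> subseq t v -> subseq t (p ++ n.+1 :: s).
    by rewrite /v; case: t => [|x t] /=; [rewrite sub0seq | move=> /negPf->].
  split=> //.
  + move=> a b ne_ab; apply/negP => sub.
    have [Ea|ne_a] := eqVneq a n.+1.
      move: sub; rewrite Ea /v /= eqxx.
      move/(@subseq_cat_split _ n.+1 _ _ [:: b; b] [::] Mp Ms).
      by rewrite (negPf (no_pair b)).
    (* If [b] is the new letter, both its copies would have to follow [a],
       but its first copy is the head. *)
    have [Eb|ne_b] := eqVneq b n.+1; last first.
      case/negP: (av1 a b ne_ab); apply: old => //.
      by rewrite !inE !negb_or ![n.+1 == _]eq_sym ne_a ne_b.
    move/(tailM [:: a; b; b; a] ne_a)/leq_count_subseq: sub => /(_ (pred1 n.+1)).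
    rewrite count_cat /= Eb eqxx (negPf ne_a) (count_memPn Mp) (count_memPn Ms).
    by [].
  + move=> a b c lt_abc; apply/negP => sub.
    have le_c : c <= n.+1 by apply/mem_v/(mem_subseq sub); rewrite !inE eqxx orbT.
    have [Ec|ne_c] := eqVneq c n.+1; last first.
      case/negP: (av2 a b c lt_abc); apply: old => //.
      by rewrite !inE; lia.
    move: (tailM [:: a; c; b; b]); rewrite sub /= => /(_ _ isT).
    have -> : a != n.+1 by lia.
    rewrite Ec => /(_ isT)/(@subseq_cat_split _ n.+1 _ _ [:: a] _ Mp Ms).
    rewrite sub1seq subseq_pair => /andP[a_p b_s].
    have := count_w b; rewrite count_cat => count_b.
    have : b \notin p by apply/count_memPn; lia.
    have : size p <= n.
      rewrite -(size_iota 1 n) uniq_leq_size // => x x_p.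
      by rewrite mem_iota add1n ltnS -(mem_avoider av_w) mem_cat x_p.
    by move=> le_p; move: a_p; rewrite !(mem_top_letters _ le_p top_p); lia.
  + move=> a b c lt_abc; apply/negP => sub.
    have le_c : c <= n.+1.
      by apply/mem_v/(mem_subseq sub); rewrite !inE eqxx !orbT.
    have [Ec|ne_c] := eqVneq c n.+1; last first.
      case/negP: (av3 a b c lt_abc); apply: old => //.
      by rewrite !inE; lia.
    move: (tailM [:: b; b; c; a]); rewrite sub /= => /(_ _ isT).
    have -> : b != n.+1 by lia.
    rewrite Ec => /(_ isT)/(@subseq_cat_split _ n.+1 _ _ [:: b; b] _ Mp Ms).
    by rewrite (negPf (no_pair b)).
Qed.

(** * The largest letter is at exactly one end *)

Lemma split_twice (T : eqType) (x : T) u :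
  1 < count_mem x u -> exists p q r, u = p ++ x :: q ++ x :: r.
Proof.
elim: u => //= y u IHu; case: eqP => [->|_].
  rewrite add1n ltnS -has_count has_pred1 => /splitPr[q r].
  by exists [::], q, r.
by move=> /IHu[p [q [r ->]]]; exists (y :: p), q, r.
Qed.

(** Let [x] and [y] be the end letters and suppose that neither is the maximum
    [M].  Nonnesting puts the other copy of [x] before the last [M] and the
    other copy of [y] after the first [M], so [x x M y] and [x M y y] are both
    subsequences.  Either [y < x], and the former is an occurrence of 2231, or
    [x < y], and the latter is an occurrence of 1322.  If both ends are [M],
    then any other letter is nested between them. *)
Lemma head_last_max n v : 0 < n -> avoider n.+1 v ->
  (head 0 v == n.+1) = (last 0 v != n.+1).
Proof.
move=> n_gt0 av_v; have count_v := count_avoider av_v.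
have mem_v := mem_avoider av_v.
have [_ av1 av2 av3] := av_v.
have := size_avoider av_v.
case: v => [|x v] // in av_v count_v mem_v av1 av2 av3 *.
case/lastP: v => [|u y] // in av_v count_v mem_v av1 av2 av3 * => _.
rewrite /= last_rcons; set M := n.+1.
have count_u z : (x == z) + (count_mem z u + (y == z)) = (0 < z <= M) * 2.
  by rewrite -count_v /= -cats1 count_cat /= addn0.
have ends s : subseq s u -> subseq (x :: rcons s y) (x :: rcons u y).
  by move=> sub; rewrite /= eqxx -!cats1 cat_subseq ?subseq_refl.
(* Any letter other than [M] would do in place of 1; it exists as [0 < n]. *)
have [Ex|ne_x] := eqVneq x M; have [Ey|ne_y] //= := eqVneq y M.
  have : M != 1 by rewrite /M; lia.
  case/av1/negP; rewrite -{1}Ex -Ey; apply: (ends [:: 1; 1]).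
  by rewrite subseq_pair; have := count_u 1; rewrite Ex Ey /M; lia.
have ne_xy : x != y.
  apply/eqP=> Exy; case/negP: (av1 _ _ ne_x).
  rewrite {2}Exy; apply: (ends [:: M; M]); rewrite subseq_pair.
  by have := count_u M; rewrite (negPf ne_x) (negPf ne_y); lia.
have : 1 < count_mem M u.
  by have := count_u M; rewrite (negPf ne_x) (negPf ne_y); lia.
case/split_twice=> p [q [r def_u]].
have x_le : 0 < x <= M by rewrite -mem_v mem_head.
have y_le : 0 < y <= M by rewrite -mem_v inE mem_rcons mem_head orbT.
have x_u : x \in u.
  by rewrite -has_pred1 has_count; have := count_u x; rewrite eqxx x_le; lia.
have y_u : y \in u.
  by rewrite -has_pred1 has_count; have := count_u y; rewrite eqxx y_le; lia.
have sub_u s : subseq s [:: M; M] -> subseq s u.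
  move/subseq_trans; apply; rewrite def_u.
  rewrite -[[:: M; M]]/([::] ++ [:: M; M]) cat_subseq ?sub0seq //= eqxx.
  by rewrite -[[:: M]]/([::] ++ [:: M]) cat_subseq ?sub0seq //= eqxx sub0seq.
have xM : subseq [:: x; M] u.
  rewrite def_u; move: x_u; rewrite def_u -cat_cons catA mem_cat => /orP[x_pq|].
    by rewrite -[[:: x; M]]/([:: x] ++ [:: M]) cat_subseq ?sub1seq ?mem_head.
  rewrite inE (negPf ne_x) /= => x_r; case/negP: (av1 _ _ ne_x).
  rewrite -(cat1s x) -cat1s cat_subseq ?sub1seq ?mem_head //.
  apply: (subseq_trans _ (subseq_rcons _ _)); rewrite def_u.
  rewrite -[[:: M; M; x]]/([:: M] ++ [:: M; x]) -cat_cons catA cat_subseq //.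
    by rewrite sub1seq mem_cat mem_head orbT.
  by rewrite /= eqxx sub1seq.
have My : subseq [:: M; y] u.
  rewrite def_u; move: y_u; rewrite def_u mem_cat => /orP[y_p|].
    have ne_y' : y != M by [].
    case/negP: (av1 _ _ ne_y').
    apply: (subseq_trans _ (subseq_cons _ _)).
    rewrite -cats1 -[[:: y; M; M; y]]/(([:: y] ++ [:: M; M]) ++ [:: y]).
    rewrite cat_subseq // def_u cat_subseq ?sub1seq //=.
    by rewrite eqxx sub1seq mem_cat mem_head orbT.
  rewrite inE (negPf ne_y) /= => y_qr.
  rewrite -[[:: M; y]]/([::] ++ [:: M; y]) cat_subseq ?sub0seq //=.
  by rewrite eqxx sub1seq.
have {xM} := ends _ xM; have {My} := ends _ My.
case: (ltngtP x y) ne_xy => // [lt_xy|lt_yx] _ sub1 sub2.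
  have lt_xyM : x < y < M by lia.
  by case/negP: (av2 _ _ _ lt_xyM).
have lt_yxM : y < x < M by lia.
by case/negP: (av3 _ _ _ lt_yxM).
Qed.

(** * Decomposition of the class on one more letter *)

Definition top_prefix n (w : seq nat) j := top_letters n (take j w).

Definition top_prefixes n w := [seq j <- iota 0 n.+1 | top_prefix n w j].

Definition wraps n : seq (seq nat) :=
  [seq wrap n j w | w <- avoiders n, j <- top_prefixes n w].

Lemma size_top_prefix n w j : avoider n w -> j <= n -> size (take j w) = j.
Proof. by move=> av_w le_j; rewrite size_takel ?(size_avoider av_w); lia. Qed.

Lemma avoider_wrap n w j : avoider n w -> top_prefix n w j ->
  avoider n.+1 (wrap n j w).
Proof.
by move=> av_w top_j; apply/avoider_wrapE; rewrite cat_take_drop.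
Qed.

Lemma avoider_unwrap n v : avoider n.+1 v -> head 0 v = n.+1 ->
  exists w j, [/\ avoider n w, j <= n, top_prefix n w j & v = wrap n j w].
Proof.
move=> av_v; case: v => [|x v] //= in av_v * => Ex.
rewrite {x}Ex in av_v *.
have M_v : n.+1 \in v.
  have := count_avoider av_v n.+1.
  by rewrite -has_pred1 has_count /= eqxx; lia.
case/splitPr: M_v av_v => p s /avoider_wrapE[av_w top_p].
exists (p ++ s), (size p); rewrite /top_prefix /wrap take_size_cat // drop_size_cat //.
split=> //; rewrite -(size_iota 1 n) uniq_leq_size ?(top_letters_uniq top_p) // => x x_p.
by rewrite mem_iota add1n ltnS -(mem_avoider av_w) mem_cat x_p.
Qed.

(** The word is recovered by deleting [n+1], and the length of the prefix from
    the position of the second copy of [n+1]. *)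
Lemma wrap_inj n w w' j j' :
  avoider n w -> avoider n w' -> j <= n -> j' <= n ->
  wrap n j w = wrap n j' w' -> w = w' /\ j = j'.
Proof.
move=> av_w av_w' le_j le_j' [eq_v].
have Mw u : avoider n u -> n.+1 \notin u.
  by move/mem_avoider->; rewrite ltnn andbF.
have filterM i u : avoider n u ->
    [seq x <- take i u ++ n.+1 :: drop i u | x != n.+1] = u.
  move=> av_u; rewrite filter_cat /= eqxx /= -filter_cat cat_take_drop.
  by apply/all_filterP/allP => x; apply: contraL => /eqP->; exact: Mw.
have indexM i u : avoider n u -> i <= n ->
    index n.+1 (take i u ++ n.+1 :: drop i u) = i.
  move=> av_u le_i; rewrite index_cat.
  have /negPf-> : n.+1 \notin take i u.
    by apply: contra (Mw u av_u); exact: mem_take.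
  by rewrite /= eqxx addn0 (size_top_prefix av_u).
split; first by rewrite -(filterM j w) // eq_v filterM.
by rewrite -(indexM j w) // eq_v indexM.
Qed.

Lemma mem_wraps n v :
  (v \in wraps n) = (v \in avoiders n.+1) && (head 0 v == n.+1).
Proof.
apply/allpairsPdep/andP => [[w [j [/mem_avoiders av_w]]]|].
  rewrite mem_filter => /andP[top_j _] ->; split; last exact: eqxx.
  by apply/mem_avoiders/avoider_wrap.
case=> /mem_avoiders av_v /eqP/(avoider_unwrap av_v)[w [j]].
case=> av_w le_j top_j ->; exists w, j; split=> //; first exact/mem_avoiders.
by rewrite mem_filter top_j mem_iota ltnS.
Qed.

Lemma wraps_uniq n : uniq (wraps n).
Proof.
apply: allpairs_uniq_dep => [|w _|]; first exact: avoiders_uniq.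
  by rewrite filter_uniq ?iota_uniq.
move=> ? ? /allpairsPdep[w [j [/mem_avoiders av_w j_w ->]]].
move=> /allpairsPdep[w' [j' [/mem_avoiders av_w' j_w' ->]]] /=.
move: j_w j_w'; rewrite !mem_filter !mem_iota !ltnS => /andP[_ le_j] /andP[_ le_j'].
by case/(wrap_inj av_w av_w' le_j le_j') => -> ->.
Qed.

Lemma mem_avoiders_rev n w : (rev w \in avoiders n) = (w \in avoiders n).
Proof.
by apply/mem_avoiders/mem_avoiders => /avoider_rev; rewrite ?revK.
Qed.

Lemma last_rev_head (T : Type) (x : T) s : last x s = head x (rev s).
Proof. by case/lastP: s => // s y; rewrite last_rcons rev_rcons. Qed.

(** The generating tree: every word is obtained exactly once, either by
    wrapping a top prefix or as the reversal of such a word. *)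
Lemma perm_avoidersS n : 0 < n ->
  perm_eq (avoiders n.+1) (wraps n ++ [seq rev v | v <- wraps n]).
Proof.
move=> n_gt0; have rev_inj := inv_inj (@revK nat).
have mem_revs v : (v \in [seq rev v | v <- wraps n]) =
    (v \in avoiders n.+1) && (last 0 v == n.+1).
  by rewrite -[v in LHS]revK mem_map // mem_wraps mem_avoiders_rev last_rev_head.
apply: uniq_perm; first exact: avoiders_uniq.
  rewrite cat_uniq wraps_uniq map_inj_uniq // wraps_uniq andbT /=.
  apply/hasPn => v; rewrite mem_revs mem_wraps => /andP[/mem_avoiders av_v].
  by rewrite (head_last_max n_gt0 av_v) => ->; rewrite andbF.
move=> v; rewrite mem_cat mem_wraps mem_revs -andb_orr.
case: mem_avoiders => //= av_v.
by rewrite (head_last_max n_gt0 av_v) orNb.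
Qed.

Lemma perm_avoiders_rev n : perm_eq [seq rev w | w <- avoiders n] (avoiders n).
Proof.
have rev_inj := inv_inj (@revK nat).
apply: uniq_perm; rewrite ?map_inj_uniq ?avoiders_uniq // => w.
by rewrite -[w in LHS]revK mem_map // mem_avoiders_rev.
Qed.

(** The second sum replaces the words ending with [n+1] by their reversals and
    then reindexes the class by reversal, so that the children of a word and
    those of its reversal are attached to the same summand. *)
Lemma sum_avoidersS n (F : seq nat -> nat) :
  0 < n -> {in avoiders n.+1, forall v, F (rev v) = F v} ->
  \sum_(v <- avoiders n.+1) F v =
  \sum_(w <- avoiders n)
    (\sum_(j <- top_prefixes n w) F (wrap n j w) +
     \sum_(j <- top_prefixes n (rev w)) F (wrap n j (rev w))).
Proof.
move=> n_gt0 F_rev; rewrite (perm_big _ (perm_avoidersS n_gt0)) big_cat big_map /=.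
have -> : \sum_(v <- wraps n) F (rev v) = \sum_(v <- wraps n) F v.
  by apply: eq_big_seq => v; rewrite mem_wraps => /andP[/F_rev].
rewrite big_split /= big_allpairs_dep; congr (_ + _).
by rewrite -(perm_big _ (perm_avoiders_rev n)) /= big_map.
Qed.

(** * The succession rule *)

Definition full n w := top_prefix n w n.

(** The prefix of length [n] is left out: it is recorded by [full], and since
    fullness is invariant under reversal it would be counted twice. *)
Definition num_tops n w := count (top_prefix n w) (iota 0 n).

Lemma top_prefix0 n w : top_prefix n w 0.
Proof. by rewrite /top_prefix take0. Qed.

Lemma num_tops_gt0 n w : 0 < n -> 0 < num_tops n w.
Proof. by case: n => //= n _; rewrite /num_tops /= top_prefix0. Qed.

(** The two halves of the word complement each other to two copies of each
    letter, so one is a permutation exactly when the other one is. *)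
Lemma full_rev n w : avoider n w -> full n (rev w) = full n w.
Proof.
suff half u : avoider n u -> full n u -> full n (rev u).
  move=> av_w; apply/idP/idP; last exact: half.
  by move/(half _ (avoider_rev av_w)); rewrite revK.
move=> av_u; have sz_u := size_avoider av_u.
rewrite /full /top_prefix /top_letters (size_top_prefix av_u) //.
rewrite (size_top_prefix (avoider_rev av_u)) // subSnn => top_u.
rewrite take_rev sz_u perm_rev; have -> : n * 2 - n = n by lia.
apply/allP => x _ /=; have := count_avoider av_u x.
rewrite -{1}(cat_take_drop n u) count_cat (permP top_u) count_uniq_mem ?iota_uniq //.
by rewrite mem_iota add1n ltnS muln2 -addnn => /addnI->.
Qed.

Lemma top_letters_max_cons n t :
  size t <= n -> top_letters n.+1 (n.+1 :: t) = top_letters n t.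
Proof.
move=> le_t; rewrite /top_letters [size (_ :: _)]/= subSS.
have -> : iota (n.+1 - size t) (size t).+1 =
    rcons (iota (n.+1 - size t) (size t)) n.+1.
  by rewrite -[(size t).+1]addn1 iotaD cats1 /=; congr rcons; lia.
by rewrite perm_sym perm_rcons perm_cons perm_sym.
Qed.

Lemma iota0S n : iota 0 n.+1 = rcons (iota 0 n) n.
Proof. by rewrite -[in LHS](addn1 n) iotaD cats1. Qed.

Lemma count_leq_iota (p : pred nat) j n :
  count (fun i => (i <= j) && p i) (iota 0 n) = count p (iota 0 (minn j.+1 n)).
Proof.
elim: n => [|n IHn]; first by rewrite minn0.
rewrite iota0S -cats1 count_cat IHn /=; case: (leqP n j) => [le_nj|lt_jn] /=.
  have -> : minn j.+1 n = n by lia.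
  have -> : minn j.+1 n.+1 = n.+1 by lia.
  by rewrite iota0S -cats1 count_cat.
have -> : minn j.+1 n = j.+1 by lia.
have -> : minn j.+1 n.+1 = j.+1 by lia.
by rewrite !addn0.
Qed.

Section Wrap.

Variables (n j : nat) (w : seq nat).
Hypotheses (av_w : avoider n w) (le_jn : j <= n).
Hypothesis top_j : top_prefix n w j.

Let av_wrap : avoider n.+1 (wrap n j w).
Proof. exact: avoider_wrap. Qed.

(** A prefix that goes beyond the second copy of [n+1] repeats this letter, so
    the top prefixes of the new word come from those of [w] of length at most
    [j]. *)
Lemma top_prefix_wrap i : i <= n ->
  top_prefix n.+1 (wrap n j w) i.+1 = (i <= j) && top_prefix n w i.
Proof.
move=> le_in; have sz_j := size_top_prefix av_w le_jn.
have sz_i := size_top_prefix av_w le_in.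
rewrite /top_prefix /wrap /= take_cat sz_j; case: ltngtP => [lt_ij|lt_ji|eq_ij] /=.
- by rewrite take_takel ?(ltnW lt_ij) // top_letters_max_cons ?sz_i.
- apply/negP => /top_letters_uniq /=.
  by rewrite -(subnSK lt_ji) /= mem_cat mem_head orbT.
- by rewrite eq_ij subnn take0 cats0 top_letters_max_cons ?sz_j.
Qed.

(** At least [n] letters other than [n+1] follow its second copy, so a short
    nonempty prefix of the reversed word lacks the largest letter. *)
Lemma top_prefix_rev_wrap i : 0 < i <= n ->
  top_prefix n.+1 (rev (wrap n j w)) i = false.
Proof.
case/andP=> i_gt0 le_in; apply/negP => top_i.
have sz_i : size (take i (rev (wrap n j w))) = i.
  by rewrite (size_top_prefix (avoider_rev av_wrap)); lia.
have : n.+1 \in take i (rev (wrap n j w)).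
  by rewrite (mem_top_letters _ _ top_i) sz_i; lia.
rewrite /wrap rev_cons rev_cat rev_cons cat_rcons rcons_cat takel_cat => [/mem_take|].
  rewrite mem_rev => /mem_drop; rewrite (mem_avoider av_w); lia.
by rewrite size_rev size_drop (size_avoider av_w); lia.
Qed.

Lemma num_tops_wrap :
  num_tops n.+1 (wrap n j w) =
    (count (top_prefix n w) (iota 0 (minn j.+1 n))).+1.
Proof.
rewrite /num_tops /= add1n; congr _.+1.
rewrite (iotaDl 1 0) count_map.
transitivity (count (fun i => (i <= j) && top_prefix n w i) (iota 0 n)).
  by apply: eq_in_count => i; rewrite mem_iota => lt_in; exact/top_prefix_wrap/ltnW.
exact: count_leq_iota.
Qed.

Lemma num_tops_rev_wrap : num_tops n.+1 (rev (wrap n j w)) = 1.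
Proof.
rewrite /num_tops /= top_prefix0 add1n; congr _.+1; apply/eqP.
rewrite -leqn0 leqNgt -has_count; apply/hasPn => i; rewrite mem_iota => lt_i.
by rewrite top_prefix_rev_wrap.
Qed.

Lemma full_wrap : full n.+1 (wrap n j w) = (j == n).
Proof.
rewrite /full top_prefix_wrap //; apply/andP/eqP => [[le_nj _]|eq_jn]; first by lia.
by split; [lia | rewrite -[X in top_prefix _ _ X]eq_jn].
Qed.

End Wrap.

(** * Counting the descendants *)

(** The elements of a filtered interval, replaced by their ranks, are
    1, 2, ..., up to their number; this turns the children of a word into the
    labels 1, 2, ... of the succession rule. *)
Lemma sum_count_rank (p : pred nat) (f : nat -> nat) n :
  \sum_(j <- iota 0 n | p j) f (count p (iota 0 j.+1)) =
  \sum_(1 <= i < (count p (iota 0 n)).+1) f i.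
Proof.
elim: n => [|n IHn]; first by rewrite big_nil big_geq.
rewrite {1}iota0S -cats1 big_cat IHn big_cons big_nil !iota0S -!cats1 count_cat /=.
by case: (p n) => /=; rewrite ?addn0 // addn1 [RHS]big_nat_recr.
Qed.

(** The number of descendants [r] levels below a word that is not full. *)
Definition free_count k r := 'C(r * 2 + k, r).

(** The part of the count for a full word that is independent of the label.
    It is the sum of the counts for full words of label 1 over all smaller
    values of [r], and is given by a recurrence to avoid the subtraction in its closed
    form [C(2r+1, r) - 2^r]. *)
Fixpoint full_excess r :=
  if r is s.+1 then full_excess s * 2 + 'C(s * 2 + 2, s) else 0.

(** The number of descendants [r] levels below a full word. *)
Definition full_count k r := 'C(r * 2 + k.+1, r) + full_excess r.

Lemma full_excessE r : full_excess r + 2 ^ r = 'C(r * 2 + 1, r).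
Proof.
elim: r => [|r IHr] //=.
rewrite (_ : r.+1 * 2 + 1 = (r * 2 + 2).+1); last by lia.
rewrite binS (_ : 'C(r * 2 + 2, r.+1) = 'C(r * 2 + 1, r) * 2).
  by rewrite -IHr expnS; lia.
rewrite addn2 binS -[in X in X + _]bin_sub; last by lia.
by rewrite (_ : (r * 2).+1 - r.+1 = r) ?addn1; lia.
Qed.

(** The succession rule for words that are not full.  By Pascal's rule, raising
    [k] by one adds the same amount to both sides. *)
Lemma free_countS k r :
  \sum_(1 <= i < k.+2) free_count i r + free_count 1 r = free_count k r.+1.
Proof.
rewrite /free_count; elim: k => [|k IHk].
  rewrite big_nat1 (_ : r.+1 * 2 + 0 = (r * 2 + 1).+1); last by lia.
  rewrite binS -['C(r * 2 + 1, r.+1)]bin_sub; last by lia.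
  by rewrite (_ : r * 2 + 1 - r.+1 = r); lia.
rewrite big_nat_recr //= addnAC IHk.
rewrite [in RHS]addnS binS; congr (_ + 'C(_, _)); lia.
Qed.

(** The succession rule for full words: besides the children of a word that is
    not full, there are two full ones, with labels [k+1] and 1. *)
Lemma full_countS k r :
  free_count k r.+1 + full_count k.+1 r + full_count 1 r = full_count k r.+1.
Proof.
rewrite /free_count /full_count /= [in RHS]addnS binS.
rewrite (_ : r.+1 * 2 + k = r * 2 + k.+2); lia.
Qed.

(** * Summation over the generating tree *)

(** One of the two numbers is 1 and both are positive, so this is their maximum
    minus one; the symmetric form makes invariance under reversal evident. *)
Definition label n w := num_tops n w + num_tops n (rev w) - 2.

Definition descendants n r w :=
  if full n w then full_count (label n w) r else free_count (label n w) r.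

Lemma descendants_rev n r w : avoider n w ->
  descendants n r (rev w) = descendants n r w.
Proof.
by move=> av_w; rewrite /descendants /label full_rev // revK addnC.
Qed.

(** The children of [w] that start with [n+1].  The [i]-th shortest top prefix
    of length less than [n] gives a child of label [i] that is not full: the
    child has [i+1] short top prefixes and its reversal has one.  The prefix of
    length [n], if it is a top prefix, gives the full child. *)
Lemma sum_descendants_wrap n r w : avoider n w ->
  \sum_(j <- top_prefixes n w) descendants n.+1 r (wrap n j w) =
  \sum_(1 <= i < (num_tops n w).+1) free_count i r +
    (if full n w then full_count (num_tops n w) r else 0).
Proof.
move=> av_w; rewrite /top_prefixes big_filter iota0S -cats1 big_cat /=.
congr (_ + _).
  rewrite /num_tops -(sum_count_rank (top_prefix n w) (free_count^~ r)).
  rewrite big_seq_cond [RHS]big_seq_cond; apply: eq_bigr => j.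
  rewrite mem_iota => /andP[lt_jn top_j].
  rewrite /descendants /label full_wrap ?(ltnW lt_jn) // (ltn_eqF lt_jn).
  rewrite num_tops_wrap ?num_tops_rev_wrap ?(ltnW lt_jn) // (minn_idPl lt_jn).
  by rewrite addn1 subn2.
rewrite big_cons big_nil /=; rewrite -/(full n w); case: ifP => // full_w.
rewrite addn0 /descendants /label full_wrap // eqxx num_tops_wrap //.
by rewrite num_tops_rev_wrap // (minn_idPr (leqnSn n)) addn1 subn2.
Qed.

(** A word on at least two letters starts or ends with its largest letter, and
    seen from the opposite end only the empty prefix can be a short top prefix. *)
Lemma num_tops_eq1 n w : 0 < n -> avoider n w ->
  num_tops n w = 1 \/ num_tops n (rev w) = 1.
Proof.
case: n => // -[|n] _ av_w; first by left; rewrite /num_tops /= top_prefix0.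
have unwrap v : avoider n.+2 v -> head 0 v = n.+2 -> num_tops n.+2 (rev v) = 1.
  move=> av_v /(avoider_unwrap av_v)[u [j [av_u le_j top_j ->]]].
  exact: num_tops_rev_wrap.
have [/eqP|] := boolP (head 0 w == n.+2); first by right; exact: unwrap.
rewrite (head_last_max _ av_w) // negbK last_rev_head => /eqP last_w.
by left; rewrite -(revK w); apply: unwrap => //; exact: avoider_rev.
Qed.

(** The succession rule for a single word.  By symmetry it may be assumed that
    the reversal has only one short top prefix; then [w] contributes the
    children with labels 1, ..., k+1 and the reversal the one with label 1. *)
Lemma descendantsS n r w : 0 < n -> avoider n w ->
  \sum_(j <- top_prefixes n w) descendants n.+1 r (wrap n j w) +
  \sum_(j <- top_prefixes n (rev w)) descendants n.+1 r (wrap n j (rev w)) =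
  descendants n r.+1 w.
Proof.
move=> n_gt0 av_w.
wlog tops_rev : w av_w / num_tops n (rev w) = 1.
  move=> IH; case: (num_tops_eq1 n_gt0 av_w) => tops_w; last exact: IH.
  rewrite addnC -descendants_rev // -(IH (rev w)) ?revK //.
  exact: avoider_rev.
rewrite !sum_descendants_wrap ?full_rev //; last exact: avoider_rev.
rewrite /descendants /label tops_rev.
have := num_tops_gt0 w n_gt0; case: (num_tops n w) => // k _.
rewrite big_nat1 addn1 subn2 /= -full_countS -free_countS.
by case: (full n w); lia.
Qed.

(** Holds at every level [n] of the tree, so that the induction on [r] can push
    the sum one level up; at level 1 the sum has a single term. *)
Lemma num_avoiding_descendants n r : 0 < n ->
  num_avoiding (n + r) [:: [:: 1; 3; 2; 2]; [:: 2; 2; 3; 1]] =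
  \sum_(w <- avoiders n) descendants n r w.
Proof.
elim: r n => [|r IHr] n n_gt0.
  rewrite addn0 /num_avoiding -size_filter -/(avoiders n) -sum1_size.
  apply: eq_bigr => w _.
  by rewrite /descendants /full_count /free_count !bin0; case: ifP.
rewrite addnS -addSn IHr // sum_avoidersS //; last first.
  by move=> v /mem_avoiders; exact: descendants_rev.
by apply: eq_big_seq => w /mem_avoiders; exact: descendantsS.
Qed.

Lemma avoiders1 : avoiders 1 = [:: [:: 1; 1]].
Proof.
have mem_1 w : (w \in avoiders 1) = (w == [:: 1; 1]).
  apply/mem_avoiders/eqP => [[perm_w _ _ _]|->].
    have /all_pred1P -> : all (pred1 1) w by rewrite (perm_all _ perm_w).
    by rewrite (perm_size perm_w).
  have no_sub s : 2 < size s -> ~~ subseq s [:: 1; 1].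
    by apply: contraL => /size_subseq; rewrite -leqNgt.
  by split=> // *; exact: no_sub.
apply: perm_small_eq => //; apply: uniq_perm => // [|w]; first exact: avoiders_uniq.
by rewrite mem_1 inE.
Qed.

Theorem theorem3p30 (n : nat) (hn : 1 <= n) :
  num_avoiding n [:: [:: 1; 3; 2; 2]; [:: 2; 2; 3; 1]] =
    'C(2 * n, n) - 2 ^ (n - 1).
Proof.
case: n hn => // r _; rewrite -add1n num_avoiding_descendants // avoiders1.
rewrite big_cons big_nil addn0 add1n subn1 /=.
have -> : descendants 1 r [:: 1; 1] = full_count 0 r by [].
have -> : 2 * r.+1 = (r * 2 + 1).+1 by lia.
rewrite binS -['C(_, r.+1)]bin_sub; last by lia.
have -> : r * 2 + 1 - r.+1 = r by lia.
by have := full_excessE r; rewrite /full_count; lia.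
Qed.
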